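(* Let $X$ be an Alexandroff space. Then the regular closed algebra $\mathrm{RC}(X)$ with the contact relation $A\mathrel{\mathsf{C}}B \iff A\cap B\neq\emptyset$ satisfies (C4$^c$): for every $A\in\mathrm{RC}(X)$ and every family $\mathcal{S}\subseteq\mathrm{RC}(X)$, if $A\mathrel{\mathsf{C}}\bigvee\mathcal{S}$, then there is $S\in\mathcal{S}$ such that $A\mathrel{\mathsf{C}}S$.
   Context: An Alexandroff space is a topological space in which the intersection of any family of open sets is open. For a topological space $X$, $\mathrm{RC}(X)$ is the complete Boolean algebra of regular closed subsets of $X$ (sets $A\subseteq X$ with $A=\mathrm{Cl}\,\mathrm{Int}\,A$, where $\mathrm{Cl}$ and $\mathrm{Int}$ are closure and interior), with operations $A\cdot B=\mathrm{Cl}\,\mathrm{Int}(A\cap B)$, $A+B=A\cup B$, $-A=\mathrm{Cl}(X\setminus A)$, and $\bigvee\mathcal{S}=\mathrm{Cl}\bigcup\mathcal{S}$. *)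

(* Defs.v *)
From HB Require Import structures.
From mathcomp Require Import all_boot all_order.
From mathcomp Require Import all_classical.
From mathcomp Require Import topology_structure.

Set Implicit Arguments.
Unset Strict Implicit.
Unset Printing Implicit Defensive.

Local Open Scope classical_set_scope.

Definition alexandroff (X : topologicalType) : Prop :=
  forall F : set (set X), F `<=` open -> open (\bigcap_(U in F) U).

Record RC (X : topologicalType) : Type := MkRC {
  rc_set :> set X;
  rc_regclosed : regclosed rc_set }.

Lemma rc_sup_regclosed (X : topologicalType) (S : set (RC X)) :
  regclosed (closure (\bigcup_(A in S) (A : set X))).
Proof.
have -> : closure (\bigcup_(A in S) (A : set X)) =
          closure (\bigcup_(A in S) (A : set X)°).
  rewrite eqEsubset; split; last first.
    by apply: closureS => x [A SA] /interior_subset Ax; exists A.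
  rewrite [X in _ `<=` X](iffLR (closure_id _) (@closed_closure _ _)).
  apply: closureS => x [A SA]; rewrite -(rc_regclosed A).
  by apply: closureS => y Ay; exists A.
by apply: closure_open_regclosed; apply: bigcup_open => A _; exact: open_interior.
Qed.

Definition rc_sup (X : topologicalType) (S : set (RC X)) : RC X :=
  @MkRC X (closure (\bigcup_(A in S) (A : set X))) (rc_sup_regclosed S).

Lemma rc_sup_lub (X : topologicalType) (S : set (RC X)) (B : RC X) :
  (rc_sup S `<=` B) <-> (forall A : RC X, S A -> A `<=` B).
Proof.
split=> [supB A SA|ubB].
  by apply: subset_trans supB => x Ax; apply: subset_closure; exists A.
have -> : (B : set X) = closure B.
  by rewrite -(rc_regclosed B) -(iffLR (closure_id _) (@closed_closure _ _)).
by apply: closureS => x [A SA]; exact: ubB.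
Qed.

Definition rc_contact (X : topologicalType) (A B : RC X) : Prop :=
  A `&` B <> set0.

(* Main.v *)
Require Import Defs.
From mathcomp Require Import all_boot all_order.
From mathcomp Require Import all_classical.
From mathcomp Require Import topology_structure.

Local Open Scope classical_set_scope.

(** Every point of an Alexandroff space has a least open neighbourhood, so closure distributes over
    arbitrary unions ([alexandroff_closure_bigcup]). Since regular closed sets are closed, a join in
    [RC X] is then the plain union, and a point shared with the join is shared with a member. *)

Lemma regclosed_closed (X : topologicalType) (A : set X) :
  regclosed A -> closed A.
Proof. by move=> <-; exact: closed_closure. Qed.

Lemma alexandroff_closure_bigcup (X : topologicalType) (I : Type)
    (D : set I) (F : I -> set X) : alexandroff X ->
  closure (\bigcup_(i in D) F i) `<=` \bigcup_(i in D) closure (F i).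
Proof.
move=> alexX x clx.
(* The intersection of all open neighbourhoods of x is the least one, so a
   single point of it in F i witnesses that x lies in the closure of F i. *)
pose U := \bigcap_(V in [set V : set X | open V /\ V x]) V.
have oU : open U by apply: alexX => V [].
have Ux : U x by move=> V [].
have [y [[i Di Fiy] Uy]] := clx _ (open_nbhs_nbhs (conj oU Ux)).
exists i => // W; rewrite nbhsE => -[V oVx VW].
by exists y; split=> //; apply: VW; exact: Uy.
Qed.

Theorem proposition4p3 (X : topologicalType) (alexX : alexandroff X)
    (A : RC X) (S : set (RC X)) :
  rc_contact A (rc_sup S) -> exists B : RC X, S B /\ rc_contact A B.
Proof.
move=> /eqP/set0P[x [Ax /(alexandroff_closure_bigcup _ _ _ _ alexX)[B SB clBx]]].
exists B; split=> //; apply/eqP/set0P; exists x; split=> //.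
(* So far [x] is only known to lie in [closure B], which is [B] itself. *)
exact: (regclosed_closed _ _ (rc_regclosed B)).
Qed.
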